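(* Let $F$ be a finite field of characteristic $2$, and let $A=(a_{ij})_{1\le i,j\le3}$ be a symmetric $3\times3$ matrix over $F$ with $a_{12}a_{13}a_{23}\ne0$. Then iterated $2\times2\times2$ block making starting from $A$ leads, after $n$ steps (and up to a choice of basis in each of the three thick spaces), to a direct sum of $2^{2n-1}$ simple bricks and $2^{2n-2}$ double bricks, where the simple brick is $(a_{ij}^{2^n})_{1\le i,j\le3}$ and the double brick is the $6\times6$ matrix $$\begin{pmatrix} a_{11}^{2^n}\mathbf 1_2 & a_{12}^{2^n}\mathbf 1_2 & a_{13}^{2^n}\mathbf 1_2 \\ a_{12}^{2^n}\mathbf 1_2 & a_{22}^{2^n}\mathbf 1_2 & a_{23}^{2^n} T \\ a_{13}^{2^n}\mathbf 1_2 & a_{23}^{2^n} T & a_{33}^{2^n}\mathbf 1_2 \end{pmatrix},\qquad \mathbf 1_2=\begin{pmatrix}1&0\\0&1\end{pmatrix},\quad T=\begin{pmatrix}1&1\\0&1\end{pmatrix}.$$ Here $n\ge1$.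
   Context: Conventions: vectors are rows and operators/matrices act from the right, so in a product the leftmost factor is applied first. Block. Let $V_1,V_2,V_3$ be finite-dimensional vector spaces over $F$ and $B$ a linear operator (''brick'') in $V_1\oplus V_2\oplus V_3$. Let $C=\{0,1\}^3\subset\mathbb Z^3$. To every straight line parallel to the $i$-th axis through points of $C$ attach a copy of $V_i$. To every $\mathbf x\in C$ attach a copy $B^{(\mathbf x)}$ of $B$ acting in the direct sum of the copies of $V_1,V_2,V_3$ attached to the three lines meeting at $\mathbf x$, extended by the identity to the other copies. The $2\times2\times2$ block of bricks $B$ is $\prod_{\mathbf x\in C}B^{(\mathbf x)}$, in any order such that $B^{(\mathbf x)}$ stands to the left of $B^{(\mathbf y)}$ whenever $\mathbf x\ne\mathbf y$ and $x_i\le y_i$ for all $i$ (the result does not depend on this choice). It acts in $\mathbf V_1\oplus\mathbf V_2\oplus\mathbf V_3$, where the thick space $\mathbf V_i$ is the direct sum of the four copies of $V_i$. Iteration. Start with $R^{(0)}=A$, $V_1=V_2=V_3=F$; $R^{(k+1)}$ is the $2\times2\times2$ block whose brick is $R^{(k)}$, with the thick spaces of $R^{(k)}$ as the spaces $V_i$. The result after $n$ steps is $R^{(n)}$, acting in a sum of three thick spaces each of dimension $4^n$. Direct sum. The decomposition is compatible with the thick spaces: each of the three thick spaces $\mathbf V_i$ is a direct sum of subspaces $U_k^{(i)}$, such that for each $k$ the operator $R^{(n)}$ preserves $U_k^{(1)}\oplus U_k^{(2)}\oplus U_k^{(3)}$ and, in suitable bases of $U_k^{(1)},U_k^{(2)},U_k^{(3)}$,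 acts there by the $k$-th summand; $\dim U_k^{(i)}=1$ for a simple brick and $\dim U_k^{(i)}=2$ for a double brick (whose $2\times2$ blocks correspond to the three spaces). *)

(* Defs.v *)
From HB Require Import structures.
From mathcomp Require Import all_boot all_algebra.

Set Implicit Arguments.
Unset Strict Implicit.
Unset Printing Implicit Defensive.

Import GRing.Theory.
Local Open Scope ring_scope.

(* Points of the cube {0,1}^3, with the coordinatewise order. *)
Definition point : finType := (bool * bool * bool)%type.

Definition point_le (x y : point) : bool :=
  [&& (x.1.1 <= y.1.1)%N, (x.1.2 <= y.1.2)%N & (x.2 <= y.2)%N].

(* A line parallel to the i-th axis is given by its two other coordinates. *)
Definition line : finType := (bool * bool)%type.

Definition line1 (x : point) : line := (x.1.2, x.2).
Definition line2 (x : point) : line := (x.1.1, x.2).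
Definition line3 (x : point) : line := (x.1.1, x.1.2).

(* Lexicographic order; any other linear extension of point_le gives the same
   block by block_along_indep below. *)
Definition cube : seq point :=
  [:: (false, false, false); (false, false, true);
      (false, true, false);  (false, true, true);
      (true, false, false);  (true, false, true);
      (true, true, false);   (true, true, true)].

Definition cube_order (s : seq point) : Prop :=
  perm_eq s (enum point) /\
  {in s &, forall x y, x != y -> point_le x y -> (index x s < index y s)%N}.

Lemma cube_orderP : cube_order cube.
Proof.
split; last by move=> [[[] []] []] [[[] []] []].
apply: uniq_perm; rewrite ?enum_uniq // => x.
by rewrite mem_enum; case: x => [[[] []] []].
Qed.

(* Direct sum of the copies of V attached to the four lines of one direction. *)
Definition thick (F : fieldType) (V : vectType F) : vectType F :=
  {ffun line -> V}.

Definition set_copy (F : fieldType) (V : vectType F) (l : line) (w : V)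
  (f : thick V) : thick V := [ffun l' => if l' == l then w else f l'].

Section Block.
Context (F : fieldType) (V1 V2 V3 : vectType F).
Implicit Type B : 'End((V1 * V2 * V3)%type).

Definition place_fun B (x : point) (v : thick V1 * thick V2 * thick V3) :
    thick V1 * thick V2 * thick V3 :=
  let w := B (v.1.1 (line1 x), v.1.2 (line2 x), v.2 (line3 x)) in
  (set_copy (line1 x) w.1.1 v.1.1, set_copy (line2 x) w.1.2 v.1.2,
   set_copy (line3 x) w.2 v.2).

Fact place_fun_is_linear B x : linear (place_fun B x).
Proof.
move=> a [[u1 u2] u3] [[v1 v2] v3]; rewrite /place_fun /= !ffunE.
set p := (u1 _, _, _); set q := (v1 _, _, _).
have -> : (a *: u1 (line1 x) + v1 (line1 x), a *: u2 (line2 x) + v2 (line2 x),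
   a *: u3 (line3 x) + v3 (line3 x)) = a *: p + q by [].
have -> : B (a *: p + q) = a *: B p + B q by exact: linearP.
case: (B p) (B q) => [[p1 p2] p3] [[q1 q2] q3].
by congr (_, _, _); apply/ffunP=> l; rewrite !ffunE; case: eqP.
Qed.

HB.instance Definition _ B x :=
  GRing.isLinear.Build F _ _ _ (place_fun B x) (place_fun_is_linear B x).

(* The copy of B at the point x, extended by the identity. *)
Definition place B (x : point) : 'End((thick V1 * thick V2 * thick V3)%type) :=
  linfun (place_fun B x).

Lemma placeE B x v : place B x v = place_fun B x v.
Proof. by rewrite lfunE. Qed.

(* Operators act on row vectors from the right, so the leftmost factor of a
   product (the head of s) is applied first. *)
Definition block_along B (s : seq point) :
    'End((thick V1 * thick V2 * thick V3)%type) :=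
  foldl (fun P x => (place B x \o P)%VF) \1%VF s.

Definition block B := block_along B cube.

Lemma block_alongE B s v :
  block_along B s v = foldl (fun w x => place_fun B x w) v s.
Proof.
rewrite /block_along -[in RHS](id_lfunE v); move: \1%VF => P.
by elim: s P => [|x s IHs] P //=; rewrite IHs comp_lfunE placeE.
Qed.

Lemma place_fun_comm B x y v : ~~ point_le x y -> ~~ point_le y x ->
  place_fun B x (place_fun B y v) = place_fun B y (place_fun B x v).
Proof.
move=> nxy nyx.
have [n1 n2 n3] : [/\ line1 x != line1 y, line2 x != line2 y
                    & line3 x != line3 y].
  by move: x y nxy nyx => [[[] []] []] [[[] []] []].
rewrite /place_fun /= !ffunE !(negPf n1, negPf n2, negPf n3).
rewrite !(eq_sym (line1 y), eq_sym (line2 y), eq_sym (line3 y)).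
rewrite !(negPf n1, negPf n2, negPf n3).
by congr (_, _, _); apply/ffunP=> l; rewrite !ffunE;
  case: eqP => // ->; rewrite ?(negPf n1, negPf n2, negPf n3).
Qed.

Lemma block_along_indep B s : cube_order s -> block_along B s = block B.
Proof.
pose ord t := {in t &, forall x y : point,
  x != y -> point_le x y -> (index x t < index y t)%N}.
have [cubeU cubeP] := cube_orderP; rewrite -/(ord cube) in cubeP.
case=> sU sP; rewrite -/(ord s) in sP.
have {cubeU sU} st : perm_eq s cube by rewrite (perm_trans sU) // perm_sym.
have tU : uniq cube by [].
apply/lfunP=> v; rewrite !block_alongE.
elim: s cube v sP cubeP st tU => [|x s IHs] t v sP tP st tU.
  by rewrite perm_sym in st; move/perm_nilP: st => ->.
have xt : x \in t by rewrite -(perm_mem st) mem_head.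
case/splitPr: xt tP st tU => t1 t2 tP st tU.
have xsU : uniq (x :: s) by rewrite (perm_uniq st).
have st' : perm_eq s (t1 ++ t2).
  by rewrite -(perm_cons x) (perm_trans st) // perm_catC /= perm_cons perm_catC.
have [xs sU] : x \notin s /\ uniq s by move: xsU => /= /andP.
have [xt12 tU'] : x \notin t1 ++ t2 /\ uniq (t1 ++ t2).
  by apply/andP; move: tU; rewrite uniq_catC /= mem_cat orbC -mem_cat uniq_catC.
have xt1 : x \notin t1 by move: xt12; rewrite mem_cat; case/norP.
have ord_s : ord s.
  move=> y z ys zs yz lyz; have := sP y z.
  rewrite !inE ys zs !orbT => /(_ isT isT yz lyz) /=.
  have [xy|_] := eqVneq x y; first by rewrite xy ys in xs.
  by have [xz|_] := eqVneq x z; first by rewrite xz zs in xs.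
have ord_t : ord (t1 ++ t2).
  move=> y z yt zt yz lyz.
  have yx : x != y by apply: contraNneq xt12 => ->.
  have zx : x != z by apply: contraNneq xt12 => ->.
  have := tP y z; rewrite !(mem_cat, inE) in yt zt *.
  rewrite !(orbCA (_ \in t1)) yt zt !orbT => /(_ isT isT yz lyz).
  rewrite !index_cat /= (negPf yx) (negPf zx).
  case: (boolP (y \in t1)) => [y1|_]; case: (boolP (z \in t1)) => [z1|_] //.
  - by move=> _; rewrite (leq_trans _ (leq_addr _ _)) // index_mem.
  - by rewrite ltnNge (leq_trans (ltnW _) (leq_addr _ _)) // index_mem.
  - by rewrite !ltn_add2l ltnS.
rewrite /= (IHs (t1 ++ t2)) // !foldl_cat /=; congr foldl.
have {IHs ord_t ord_s}: {in t1, forall y, ~~ point_le x y /\ ~~ point_le y x}.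
  move=> y y1.
  have nyx : y != x by apply: contraNneq xt1 => <-.
  have xt : x \in t1 ++ x :: t2 by rewrite mem_cat mem_head orbT.
  have yt : y \in t1 ++ x :: t2 by rewrite mem_cat y1.
  split; apply/negP => le.
    have := tP x y xt yt; rewrite eq_sym => /(_ nyx le).
    rewrite !index_cat (negPf xt1) y1 /= eqxx addn0 ltnNge ltnW //.
    by rewrite index_mem.
  have ys : y \in x :: s by rewrite (perm_mem st).
  by have := sP y x ys (mem_head _ _) nyx le; rewrite /= eqxx ltn0.
elim: t1 v {st st' tU tU' tP xt12 xt1} => [|y t1 IHt] v //= inc.
have [nxy nyx] := inc y (mem_head _ _).
rewrite place_fun_comm // IHt // => z z1; apply: inc.
by rewrite inE z1 orbT.
Qed.

End Block.

Section Iteration.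
Context (F : fieldType) (A : 'M[F]_3).

Definition matrix_brick_fun (v : F^o * F^o * F^o) : F^o * F^o * F^o :=
  let y j := v.1.1 * A 0 j + v.1.2 * A 1 j + v.2 * A 2 j in (y 0, y 1, y 2).

Fact matrix_brick_fun_is_linear : linear matrix_brick_fun.
Proof.
move=> a [[u1 u2] u3] [[v1 v2] v3]; rewrite /matrix_brick_fun /=.
have lin (i j k : F) : (a * u1 + v1) * i + (a * u2 + v2) * j + (a * u3 + v3) * k
    = a * (u1 * i + u2 * j + u3 * k) + (v1 * i + v2 * j + v3 * k).
  rewrite !mulrDl !mulrDr !mulrA [RHS]addrACA; congr (_ + _).
  by rewrite [RHS]addrACA.
by congr (_, _, _); apply: lin.
Qed.

HB.instance Definition _ :=
  GRing.isLinear.Build F _ _ _ matrix_brick_fun matrix_brick_fun_is_linear.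

Definition matrix_brick : 'End((F^o * F^o * F^o)%type) :=
  linfun matrix_brick_fun.

Lemma matrix_brickE v : matrix_brick v = matrix_brick_fun v.
Proof. by rewrite lfunE. Qed.

Fixpoint iter_space (n : nat) : vectType F :=
  if n is k.+1 then thick (iter_space k) else F^o.

Fixpoint iter_block (n : nat) :
    'End((iter_space n * iter_space n * iter_space n)%type) :=
  match n with
  | 0 => matrix_brick
  | k.+1 => block (iter_block k)
  end.

Lemma dim_iter_space n : \dim {: iter_space n} = (4 ^ n)%N.
Proof.
rewrite dimvf; elim: n => [|n IHn] //=.
by rewrite expnS -IHn [LHS]/(#|line| * _)%N card_prod card_bool.
Qed.

End Iteration.

(* A brick in coordinates, acting on 'rV_d1 (+) 'rV_d2 (+) 'rV_d3. *)
Record mxbrick (F : fieldType) := MxBrick {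
  bdim1 : nat;
  bdim2 : nat;
  bdim3 : nat;
  bmx : 'M[F]_(bdim1 + bdim2 + bdim3)
}.

Section DirectSum.
Context (F : fieldType) (W1 W2 W3 : vectType F).

(* The vector with coordinates c in the concatenation of e1, e2, e3. *)
Definition vec3 d1 d2 d3 (e1 : d1.-tuple W1) (e2 : d2.-tuple W2)
    (e3 : d3.-tuple W3) (c : 'rV[F]_(d1 + d2 + d3)) : W1 * W2 * W3 :=
  (\sum_i lsubmx (lsubmx c) 0 i *: tnth e1 i,
   \sum_i rsubmx (lsubmx c) 0 i *: tnth e2 i,
   \sum_i rsubmx c 0 i *: tnth e3 i).

Definition preserves3 (R : 'End((W1 * W2 * W3)%type))
    (U1 : {vspace W1}) (U2 : {vspace W2}) (U3 : {vspace W3}) : Prop :=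
  forall v, [/\ v.1.1 \in U1, v.1.2 \in U2 & v.2 \in U3] ->
    [/\ (R v).1.1 \in U1, (R v).1.2 \in U2 & (R v).2 \in U3].

Definition acts_as (R : 'End((W1 * W2 * W3)%type))
    (U1 : {vspace W1}) (U2 : {vspace W2}) (U3 : {vspace W3})
    (b : mxbrick F) : Prop :=
  exists (e1 : (bdim1 b).-tuple W1) (e2 : (bdim2 b).-tuple W2)
         (e3 : (bdim3 b).-tuple W3),
    [/\ basis_of U1 e1, basis_of U2 e2, basis_of U3 e3
      & forall c, R (vec3 e1 e2 e3 c) = vec3 e1 e2 e3 (c *m bmx b)].

Definition direct_decomp (W : vectType F) (K : finType)
    (U : K -> {vspace W}) : Prop :=
  directv (\sum_k U k) /\ (\sum_k U k)%VS = fullv.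

(* R is, up to a choice of basis in each of W1, W2, W3, the direct sum of the
   bricks b k. *)
Definition is_direct_sum (R : 'End((W1 * W2 * W3)%type)) (K : finType)
    (b : K -> mxbrick F) : Prop :=
  exists (U1 : K -> {vspace W1}) (U2 : K -> {vspace W2})
         (U3 : K -> {vspace W3}),
    [/\ direct_decomp U1, direct_decomp U2, direct_decomp U3
      & forall k, preserves3 R (U1 k) (U2 k) (U3 k) /\
                  acts_as R (U1 k) (U2 k) (U3 k) (b k)].

End DirectSum.

Section Bricks.
Context (F : fieldType).

Definition simple_brick (M : 'M[F]_3) : mxbrick F :=
  @MxBrick F 1 1 1 M.

Definition Tmx : 'M[F]_2 := \matrix_(i, j) (i <= j)%N%:R.

Definition double_brick (M : 'M[F]_3) : mxbrick F :=
  @MxBrick F 2 2 2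
    (block_mx
       (block_mx (M 0 0)%:M (M 0 1)%:M
                 (M 0 1)%:M (M 1 1)%:M)
       (col_mx (M 0 2)%:M (M 1 2 *: Tmx))
       (row_mx (M 0 2)%:M (M 1 2 *: Tmx))
       (M 2 2)%:M).

Definition entrywise_pow (A : 'M[F]_3) (m : nat) : 'M[F]_3 :=
  map_mx (fun a => a ^+ m) A.

End Bricks.

(* Main.v *)
From Stdlib Require Import Ring.
From HB Require Import structures.
Require Import Defs.
From mathcomp Require Import all_boot all_algebra.

Set Implicit Arguments.
Unset Strict Implicit.
Unset Printing Implicit Defensive.

Import GRing.Theory.
Local Open Scope ring_scope.

(** A symmetric brick is deformed by putting an involution [t] on its entry
    [a23]: [twisted_brick A t] acts on three copies of a space [V] carrying [t].
    With [V = F] and [t = 1] this is the brick [A]; with [V = F^2] and [t = T] it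
    is a double brick; and if [t = 1 + N] with [N] of square zero, a Jordan basis
    of [N] splits it into simple bricks (one for each Jordan block of size 1) and
    double bricks (one for each block of size 2). So the whole direct sum can be
    carried by a single involution.

    The point is that this family is stable under block making: the block of
    [twisted_brick A t] is, after a change of basis in each thick space, the
    twisted brick with the squared entries and some involution [t'] of [thick V].
    Write [R_ij] for the component of the block from the i-th to the j-th thick
    space. It is a sum over walks through the cube that enter it along the i-th
    axis and leave it along the j-th one, a turn from axis k to axis l
    contributing [a_kl]. Three facts are needed.
    - [R_ii = a_ii^2]. Reversing a walk preserves its weight, [A] being symmetric,
      so in characteristic 2 only palindromic walks count; the cube has two layers
      in each direction, and only the straight walk is a palindrome.
    - [R_ij] followed by [R_ji] is [a_ij^4], so that [R_12 / a12^2] and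
      [R_13 / a13^2] are invertible and may serve as changes of basis in the
      second and third thick spaces. They turn the components from the first
      space and back into the scalars [a12^2] and [a13^2], and [R_23] into
      [a23^2] times the operator [t'] obtained by going around the triangle
      1 -> 2 -> 3 -> 1 and dividing by [(a12 a13 a23)^2].
    - This [t'] equals [1 + N'], where, up to a scalar, [N'] is the composite of a
      surjection [defect_form : thick V -> V] and an injection
      [defect_vec : V -> thick V] whose composite in the other order vanishes.
      So [N'] has square zero and rank [\dim V].

    These are [block_twisted_brickE], [comp21_comp12] and its companions, and
    [comp23_comp12] with [comp32_comp13]; together they give
    [block_similar3_twisted_brick]. Iterating from [t = 1] on [V = F], after
    [n >= 1] steps [t - 1] has rank [4^(n-1)] on a space of dimension [4^n]: that is
    [4^(n-1) = 2^(2n-2)] Jordan blocks of size 2, and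
    [4^n - 2 * 4^(n-1) = 2^(2n-1)] of size 1. *)

(** * Twisted bricks *)

Section TwistedBrick.
Variables (F : fieldType) (V : vectType F) (A : 'M[F]_3) (t : 'End(V)).

Definition twisted_brick_fun (v : V * V * V) : V * V * V :=
  (A 0 0 *: v.1.1 + A 0 1 *: v.1.2 + A 0 2 *: v.2,
   A 0 1 *: v.1.1 + A 1 1 *: v.1.2 + A 1 2 *: t v.2,
   A 0 2 *: v.1.1 + A 1 2 *: t v.1.2 + A 2 2 *: v.2).

Fact twisted_brick_fun_is_linear : linear twisted_brick_fun.
Proof.
have lin3 k (a1 a2 a3 : F) (x1 x2 x3 y1 y2 y3 : V) :
    a1 *: (k *: x1 + y1) + a2 *: (k *: x2 + y2) + a3 *: (k *: x3 + y3) =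
    k *: (a1 *: x1 + a2 *: x2 + a3 *: x3) + (a1 *: y1 + a2 *: y2 + a3 *: y3).
  rewrite !scalerDr !scalerA ![_ * k]mulrC (addrACA (_ *: x1)).
  by rewrite (addrACA (_ *: x1 + _ *: x2)).
move=> k [[x1 x2] x3] [[y1 y2] y3]; rewrite /twisted_brick_fun /= !(linearP t) /=.
by congr (_, _, _) => /=; rewrite lin3.
Qed.

HB.instance Definition _ :=
  GRing.isLinear.Build F _ _ _ twisted_brick_fun twisted_brick_fun_is_linear.

Definition twisted_brick : 'End((V * V * V)%type) := linfun twisted_brick_fun.

Lemma twisted_brickE v : twisted_brick v = twisted_brick_fun v.
Proof. by rewrite lfunE. Qed.

End TwistedBrick.

(** * Linear identities in characteristic two *)

Section Char2.
Variables (F : fieldType) (char2 : 2%N \in [pchar F]).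

(** Operations on [F] with a fixed syntactic form, on which [ring] can be
    declared. Its coefficients are taken in [bool], the field with two elements,
    so that normal forms are computed modulo 2. *)
Definition carrier2 : Type := F.
Definition add2 (x y : carrier2) : carrier2 := (x : F) + (y : F).
Definition mul2 (x y : carrier2) : carrier2 := (x : F) * (y : F).
Definition bool2 (b : bool) : carrier2 := (b%:R : F).

Fact ring_theory2 : ring_theory (bool2 false) (bool2 true) add2 mul2 add2 id eq.
Proof.
split; rewrite /add2 /mul2.
- exact: (@add0r F).
- exact: (@addrC F).
- exact: (@addrA F).
- exact: (@mul1r F).
- exact: (@mulrC F).
- exact: (@mulrA F).
- exact: (@mulrDl F).
- by [].
- by move=> x; rewrite addrr_pchar2.
Qed.

Fact ring_morph2 : ring_morph (bool2 false) (bool2 true) add2 mul2 add2 id eq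
  false true xorb andb xorb id Bool.eqb bool2.
Proof.
split=> //.
- by case=> [] []; rewrite /bool2 /add2 ?addr0 ?add0r ?addrr_pchar2.
- by case=> [] []; rewrite /bool2 /add2 ?addr0 ?add0r ?addrr_pchar2.
- by case=> [] []; rewrite /bool2 /mul2 ?mulr1 ?mulr0 ?mul0r.
- by case=> [] [].
Qed.

Ltac bool2_cst t :=
  match t with
  | bool2 ?b => constr:(b)
  | _ => constr:(InitialRing.NotConstant)
  end.

Add Ring ring2 : ring_theory2 (morphism ring_morph2, constants [bool2_cst]).

Fact scalar_add (k l : F) (c d : carrier2) :
  k = c -> l = d -> k + l = add2 c d.
Proof. by move=> -> ->. Qed.

Fact scalar_mul (k l : F) (c d : carrier2) :
  k = c -> l = d -> k * l = mul2 c d.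
Proof. by move=> -> ->. Qed.

Fact scalar_sqr (k : F) (c : carrier2) : k = c -> k ^+ 2 = mul2 c c.
Proof. by move=> ->. Qed.

Section Vectors.
Variable V : vectType F.
Implicit Types (t : 'End(V)).

Definition form2 (f : V -> carrier2) : Prop :=
  (forall x y : V, f (x + y) = add2 (f x) (f y)) /\
  (forall k (x : V), f (k *: x) = mul2 k (f x)).

(** Linear forms separate points: an identity between vectors becomes an identity
    in [F], within reach of [ring], the values of the form being its atoms. *)
Lemma vect_ext (x y : V) : (forall f, form2 f -> f x = f y) -> x = y.
Proof.
move=> fxy; rewrite (coord_vbasis (memvf x)) (coord_vbasis (memvf y)).
apply: eq_bigr => i _; congr (_ *: _); apply: fxy; split=> [u v|k u].
  exact: linearD.
exact: linearZ.
Qed.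

Fact form2_comp f t : form2 f -> form2 (f \o t).
Proof.
by case=> fD fZ; split=> [x y|k x] /=; rewrite ?linearD ?linearZ ?fD ?fZ.
Qed.

(** Under an involution [t] the atoms are the values of [f] and of [g = f \o t],
    which [t] exchanges; this builds the relation [t^2 = 1] into the
    evaluation. *)
Lemma vect_ext_involution t (x y : V) : involutive t ->
  (forall f g, form2 f -> form2 g ->
     (forall u, f (t u) = g u) -> (forall u, g (t u) = f u) -> f x = f y) ->
  x = y.
Proof.
move=> tK fxy; apply: vect_ext => f ff; apply: (fxy f (f \o t)) => //=.
  exact: form2_comp.
by move=> u; rewrite tK.
Qed.

Implicit Types (f g : V -> carrier2).

Fact form_add f x y a b : form2 f -> f x = a -> f y = b -> f (x + y) = add2 a b.
Proof. by case=> fD _ <- <-. Qed.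

Fact form_scale f k x c a : form2 f -> k = c -> f x = a -> f (k *: x) = mul2 c a.
Proof. by case=> _ fZ <- <-. Qed.

Fact form_involution f g t x a : (forall u, f (t u) = g u) -> g x = a ->
  f (t x) = a.
Proof. by move=> ->. Qed.

Fact form_end f t x a : form2 f -> (form2 (f \o t) -> (f \o t) x = a) ->
  f (t x) = a.
Proof. by move=> ff; apply; apply: form2_comp. Qed.

Fact form_end_id f x a : f x = a -> f (\1%VF x) = a.
Proof. by rewrite id_lfunE. Qed.

Fact form_end_scale f k t x c a : form2 f -> k = c -> f (t x) = a ->
  f ((k *: t)%VF x) = mul2 c a.
Proof. by case=> _ fZ <- <-; rewrite scale_lfunE fZ. Qed.

Fact form_end_add f t (u : 'End(V)) x a b : form2 f -> f (t x) = a -> f (u x) = b ->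
  f ((t + u)%VF x) = add2 a b.
Proof. by case=> fD _ <- <-; rewrite add_lfunE fD. Qed.

(** A linear form is evaluated on a vector expression by one structural pass,
    linear in the size of the expression; repeated rewriting would be quadratic,
    which is felt on the components of a block. *)
Ltac eval_scalar :=
  lazymatch goal with
  | |- _ + _ = _ => eapply scalar_add; [eval_scalar | eval_scalar]
  | |- _ * _ = _ => eapply scalar_mul; [eval_scalar | eval_scalar]
  | |- _ ^+ 2 = _ => eapply scalar_sqr; eval_scalar
  | |- _ => reflexivity
  end.

Ltac eval_form :=
  lazymatch goal with
  | |- _ (_ + _) = _ => eapply form_add; [eassumption | eval_form | eval_form]
  | |- _ (_ *: _) = _ =>
      eapply form_scale; [eassumption | eval_scalar | eval_form]
  | |- _ (fun_of_lfun \1%VF _) = _ => eapply form_end_id; eval_form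
  | |- _ (fun_of_lfun (_ *: _) _) = _ =>
      eapply form_end_scale; [eassumption | eval_scalar | eval_form]
  | |- _ (fun_of_lfun (_ + _) _) = _ =>
      eapply form_end_add; [eassumption | eval_form | eval_form]
  | |- _ (fun_of_lfun _ _) = _ =>
      first [ eapply form_involution; [eassumption | eval_form]
            | eapply form_end; [eassumption | intro; eval_form] ]
  | |- _ => reflexivity
  end.

Ltac form_ring :=
  etransitivity; [eval_form | etransitivity; [| symmetry; eval_form]]; ring.

Ltac vect_ring := apply: vect_ext; intros; form_ring.

Ltac vect_ring_mod tK := apply: (vect_ext_involution tK); intros; form_ring.

(** * The components of a block of twisted bricks *)

Local Notation quadruple := (V * V * V * V)%type.

Definition quad (u : quadruple) : thick V :=
  [ffun l => match l with
             | (false, false) => u.1.1.1 | (false, true) => u.1.1.2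
             | (true, false) => u.1.2 | (true, true) => u.2
             end].

Lemma quad_eta (x : thick V) : x = quad (x (false, false), x (false, true),
  x (true, false), x (true, true)).
Proof. by apply/ffunP=> -[[] []]; rewrite ffunE. Qed.

(** [get] and [put] are reading and writing in a form that reduces by mere
    computation, which makes the eight steps of a block explicit. *)
Definition get (l : line) (u : quadruple) : V :=
  let: (u00, u01, u10, u11) := u in
  match l with
  | (false, false) => u00 | (false, true) => u01
  | (true, false) => u10 | (true, true) => u11
  end.

Definition put (l : line) (w : V) (u : quadruple) : quadruple :=
  let: (u00, u01, u10, u11) := u in
  match l with
  | (false, false) => (w, u01, u10, u11) | (false, true) => (u00, w, u10, u11)
  | (true, false) => (u00, u01, w, u11) | (true, true) => (u00, u01, u10, w)
  end.

Lemma quadE u l : quad u l = get l u.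
Proof. by case: u => [[[? ?] ?] ?]; rewrite ffunE. Qed.

Lemma set_copy_quad l w u : set_copy l w (quad u) = quad (put l w u).
Proof.
by case: u l => [[[? ?] ?] ?] [[] []]; apply/ffunP=> -[[] []]; rewrite !ffunE.
Qed.

Fact thick_linE k (x y : thick V) l : (k *: x + y) l = k *: x l + y l.
Proof. by rewrite !ffunE. Qed.

(** Let {i, j, k} be the three axes. A component [R_ij] of a block is a sum over
    walks. From the line of direction i at [(x_j, x_k)] to the line of direction j
    at [(y_i, y_k)] a walk makes [y_i] steps along i, [2 - x_j] along j, the last
    one included, and [y_k - x_k] along k. Summing the weights modulo 2 gives the
    formula below, with [a = a_ii], [b = a_jj], [p = a_ij], [q = a_ik] and
    [r = a_jk]. The coordinate along the partner axis (j in the source, i in the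
    target) comes first in both quadruples. *)
Section Transfer.
Variables (a b : F) (p q r : 'End(V)).

Definition transfer_tuple (x00 x01 x10 x11 : V) : quadruple :=
  let u0 := b *: x00 + x10 in
  let u1 := b *: x01 + x11 in
  let y0 := p u0 in
  let y1 := p u1 + q (r u0) + p (r (r x00)) in
  (y0, y1, a *: y0 + p (p (p x00)),
   a *: y1 + p (p (p x01)) + p (q (q u0)) + p (p (q (r x00)))).

Definition transfer_fun (x : thick V) : thick V :=
  quad (transfer_tuple (x (false, false)) (x (false, true))
                       (x (true, false)) (x (true, true))).

Fact transfer_fun_is_linear : linear transfer_fun.
Proof.
move=> k x y; apply/ffunP=> l; rewrite !ffunE.
case: l => [[] []] /=; vect_ring.
Qed.

HB.instance Definition _ :=
  GRing.isLinear.Build F _ _ _ transfer_fun transfer_fun_is_linear.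

Definition transfer : 'End(thick V) := linfun transfer_fun.

Lemma transfer_quad x00 x01 x10 x11 :
  transfer (quad (x00, x01, x10, x11)) = quad (transfer_tuple x00 x01 x10 x11).
Proof. by rewrite lfunE /= /transfer_fun !quadE. Qed.

End Transfer.

(** Lines are recorded with their coordinates in the order of the axes, which puts
    the coordinate along the partner axis second for the directions 1 (towards 3),
    2 (towards 3) and 3 (towards 2); [flip] restores the order used by
    [transfer]. *)
Definition flip_fun (x : thick V) : thick V := [ffun l => x (l.2, l.1)].

Fact flip_fun_is_linear : linear flip_fun.
Proof. by move=> k x y; apply/ffunP=> l; rewrite !ffunE. Qed.

HB.instance Definition _ :=
  GRing.isLinear.Build F _ _ _ flip_fun flip_fun_is_linear.

Definition flip : 'End(thick V) := linfun flip_fun.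

Lemma flip_quad x00 x01 x10 x11 :
  flip (quad (x00, x01, x10, x11)) = quad (x00, x10, x01, x11).
Proof. by rewrite lfunE; apply/ffunP=> -[[] []]; rewrite ffunE !quadE. Qed.

Section Block.
Variables (A : 'M[F]_3) (t : 'End(V)).
Hypothesis tK : involutive t.

Local Notation a11 := (A 0 0).
Local Notation a22 := (A 1 1).
Local Notation a33 := (A 2 2).
Local Notation a12 := (A 0 1).
Local Notation a13 := (A 0 2).
Local Notation a23 := (A 1 2).
Local Notation p := (a12 *: \1)%VF.
Local Notation q := (a13 *: \1)%VF.
Local Notation r := (a23 *: t)%VF.

Definition comp12 := transfer a11 a22 p q r.
Definition comp21 := transfer a22 a11 p r q.
Definition comp13 := (transfer a11 a33 q p r \o flip)%VF.
Definition comp31 := (flip \o transfer a33 a11 q r p)%VF.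
Definition comp23 := (flip \o transfer a22 a33 r p q \o flip)%VF.
Definition comp32 := (flip \o transfer a33 a22 r q p \o flip)%VF.

Definition transferE := (comp_lfunE, flip_quad, transfer_quad).

Lemma quadP (x : thick V) : exists u, x = quad u.
Proof. by eexists; apply: quad_eta. Qed.

Definition twisted_brick_step
    (v : quadruple * quadruple * quadruple) (x : point) :
    quadruple * quadruple * quadruple :=
  let: (v1, v2, v3) := v in
  let u1 := get (line1 x) v1 in
  let u2 := get (line2 x) v2 in
  let u3 := get (line3 x) v3 in
  (put (line1 x) (a11 *: u1 + a12 *: u2 + a13 *: u3) v1,
   put (line2 x) (a12 *: u1 + a22 *: u2 + a23 *: t u3) v2,
   put (line3 x) (a13 *: u1 + a23 *: t u2 + a33 *: u3) v3).

Definition quads (v : quadruple * quadruple * quadruple) :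
  thick V * thick V * thick V := (quad v.1.1, quad v.1.2, quad v.2).

Lemma foldl_place_quads s v :
  foldl (fun w x => place_fun (twisted_brick A t) x w) (quads v) s =
  quads (foldl twisted_brick_step v s).
Proof.
elim: s v => [|x s IHs] // [[v1 v2] v3].
rewrite [LHS]/= -IHs; congr foldl.
rewrite /place_fun twisted_brickE /twisted_brick_fun /quads /=.
by rewrite !quadE !set_copy_quad.
Qed.

(** The diagonal components are scalar because walks from a direction to itself
    cancel against their reversals, except the straight ones. *)
Lemma block_twisted_brickE v : block (twisted_brick A t) v =
  (a11 ^+ 2 *: v.1.1 + comp21 v.1.2 + comp31 v.2,
   comp12 v.1.1 + a22 ^+ 2 *: v.1.2 + comp32 v.2,
   comp13 v.1.1 + comp23 v.1.2 + a33 ^+ 2 *: v.2).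
Proof.
case: v => [[x1 x2] x3].
have [[[[x10 x11] x12] x13] ->] := quadP x1.
have [[[[x20 x21] x22] x23] ->] := quadP x2.
have [[[[x30 x31] x32] x33] ->] := quadP x3.
rewrite block_alongE -[X in foldl _ X _]/(quads (_, _, _)) foldl_place_quads.
rewrite /comp12 /comp21 /comp13 /comp31 /comp23 /comp32 !transferE.
rewrite /transfer_tuple; set v := (_, _, _).
cbv [foldl cube twisted_brick_step get put line1 line2 line3 fst snd quads v].
congr (_, _, _); apply/ffunP=> l; rewrite !ffunE; case: l => [[] []]; cbv [fst snd].
all: vect_ring_mod tK.
Qed.

(** Proportional to mutually inverse maps: this is what makes [comp12 / a12^2] and
    [comp13 / a13^2] eligible as changes of basis. *)
Lemma comp21_comp12 x : comp21 (comp12 x) = a12 ^+ 2 *: (a12 ^+ 2 *: x).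
Proof.
have [[[[x0 x1] x2] x3] ->] := quadP x.
rewrite /comp21 /comp12 !transferE /transfer_tuple.
apply/ffunP=> l; rewrite !ffunE; case: l => [[] []] /=; vect_ring_mod tK.
Qed.

Lemma comp31_comp13 x : comp31 (comp13 x) = a13 ^+ 2 *: (a13 ^+ 2 *: x).
Proof.
have [[[[x0 x1] x2] x3] ->] := quadP x.
rewrite /comp31 /comp13 !transferE /transfer_tuple.
apply/ffunP=> l; rewrite !ffunE; case: l => [[] []] /=; vect_ring_mod tK.
Qed.

(** The numerators of the two operators [a22 + a12 a23 t / a13] and
    [a33 + a13 a23 t / a12]. On [thick V], seen as a tensor product of two planes
    with [V], the deviation of the triangle 1 -> 2 -> 3 -> 1 from a scalar has rank
    one, its row and its column being tensor products of vectors with these two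
    operators and 1 as entries; denominators are cleared here. *)
Definition beta : 'End(V) := ((a13 * a22) *: \1 + (a12 * a23) *: t)%VF.
Definition gamma : 'End(V) := ((a12 * a33) *: \1 + (a13 * a23) *: t)%VF.

Definition defect_form_fun (x : thick V) : V :=
  beta (gamma (x (false, false))) + a12 *: beta (x (false, true))
  + a13 *: gamma (x (true, false)) + (a12 * a13) *: x (true, true).

Fact defect_form_fun_is_linear : linear defect_form_fun.
Proof.
by move=> k x y; rewrite /defect_form_fun /beta /gamma !thick_linE; vect_ring.
Qed.

HB.instance Definition _ :=
  GRing.isLinear.Build F _ _ _ defect_form_fun defect_form_fun_is_linear.

Definition defect_form : 'Hom(thick V, V) := linfun defect_form_fun.

Lemma defect_form_quad x00 x01 x10 x11 : defect_form (quad (x00, x01, x10, x11)) =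
  beta (gamma x00) + a12 *: beta x01 + a13 *: gamma x10 + (a12 * a13) *: x11.
Proof. by rewrite lfunE /= /defect_form_fun !quadE. Qed.

Definition defect_vec_fun (w : V) : thick V :=
  quad ((a12 * a13) *: w, a13 *: gamma w, a12 *: beta w, beta (gamma w)).

Fact defect_vec_fun_is_linear : linear defect_vec_fun.
Proof.
move=> k x y; apply/ffunP=> l; rewrite !ffunE.
case: l => [[] []] /=; vect_ring.
Qed.

HB.instance Definition _ :=
  GRing.isLinear.Build F _ _ _ defect_vec_fun defect_vec_fun_is_linear.

Definition defect_vec : 'Hom(V, thick V) := linfun defect_vec_fun.

Lemma defect_vecE w : defect_vec w =
  quad ((a12 * a13) *: w, a13 *: gamma w, a12 *: beta w, beta (gamma w)).
Proof. by rewrite lfunE. Qed.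

(** All four terms of the sum are equal to [a12 a13 beta gamma w]. *)
Lemma defect_form_vec w : defect_form (defect_vec w) = 0.
Proof.
rewrite defect_vecE defect_form_quad -[RHS](scale0r w) /beta /gamma.
(* The zero is written as a coefficient known to [ring]. *)
rewrite -[0 : F]/(bool2 false : F); vect_ring_mod tK.
Qed.

(** Going from space 1 to 3 through 2, compared with going there directly. Stated
    with [comp13] on the right and with denominators cleared, so as to be a
    polynomial identity. *)
Lemma comp23_comp12 x :
  a13 ^+ 2 *: (a13 ^+ 2 *: comp23 (comp12 x)) =
  (a12 * a13 * a23) ^+ 2 *: comp13 x + comp13 (defect_vec (defect_form x)).
Proof.
have [[[[x0 x1] x2] x3] ->] := quadP x.
rewrite defect_form_quad defect_vecE /beta /gamma /comp23 /comp12 /comp13.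
rewrite !transferE /transfer_tuple.
apply/ffunP=> l; rewrite !ffunE; case: l => [[] []] /=; vect_ring_mod tK.
Qed.

Lemma comp32_comp13 x :
  a12 ^+ 2 *: (a12 ^+ 2 *: comp32 (comp13 x)) =
  (a12 * a13 * a23) ^+ 2 *: comp12 x + comp12 (defect_vec (defect_form x)).
Proof.
have [[[[x0 x1] x2] x3] ->] := quadP x.
rewrite defect_form_quad defect_vecE /beta /gamma /comp32 /comp12 /comp13.
rewrite !transferE /transfer_tuple.
apply/ffunP=> l; rewrite !ffunE; case: l => [[] []] /=; vect_ring_mod tK.
Qed.

End Block.
End Vectors.

(** * Changes of basis *)

Section Similar.
Variable W : vectType F.

Definition change_basis (P1 P2 P3 : 'End(W)) (v : W * W * W) : W * W * W :=
  (P1 v.1.1, P2 v.1.2, P3 v.2).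

Definition similar3 (R S : 'End((W * W * W)%type)) : Prop :=
  exists P1 P2 P3 : 'End(W),
    [/\ lker P1 == 0%VS, lker P2 == 0%VS, lker P3 == 0%VS
      & forall v, R (change_basis P1 P2 P3 v) = change_basis P1 P2 P3 (S v)].

Lemma similar3_trans R S T : similar3 R S -> similar3 S T -> similar3 R T.
Proof.
case=> P1 [P2 [P3 [k1 k2 k3 RS]]] [Q1 [Q2 [Q3 [l1 l2 l3 ST]]]].
exists (P1 \o Q1)%VF, (P2 \o Q2)%VF, (P3 \o Q3)%VF.
have kcomp (P Q : 'End(W)) : lker P == 0%VS -> lker Q == 0%VS ->
    lker (P \o Q)%VF == 0%VS.
  move=> kP kQ; apply/lker0P => x y.
  by rewrite !comp_lfunE => /(lker0P kP) /(lker0P kQ).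
split; try exact: kcomp.
have E v : change_basis (P1 \o Q1) (P2 \o Q2) (P3 \o Q3) v =
    change_basis P1 P2 P3 (change_basis Q1 Q2 Q3 v).
  by rewrite /change_basis /= !comp_lfunE.
by move=> v; rewrite !E RS ST.
Qed.

End Similar.

Section Thick.
Variable W : vectType F.
Implicit Types P : 'End(W).

Definition thick_map_fun P (x : thick W) : thick W := [ffun l => P (x l)].

Fact thick_map_fun_is_linear P : linear (thick_map_fun P).
Proof. by move=> k x y; apply/ffunP=> l; rewrite !ffunE linearP. Qed.

HB.instance Definition _ P :=
  GRing.isLinear.Build F _ _ _ (thick_map_fun P) (thick_map_fun_is_linear P).

Definition thick_map P : 'End(thick W) := linfun (thick_map_fun P).

Lemma thick_mapE P x l : thick_map P x l = P (x l).
Proof. by rewrite lfunE /= ffunE. Qed.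

Lemma lker_thick_map P : lker P == 0%VS -> lker (thick_map P) == 0%VS.
Proof.
move=> kP; apply/lker0P => x y Pxy; apply/ffunP=> l.
by apply: (lker0P kP); rewrite -!thick_mapE Pxy.
Qed.

Lemma set_copy_thick_map P l w (x : thick W) :
  set_copy l (P w) (thick_map P x) = thick_map P (set_copy l w x).
Proof. by apply/ffunP=> k; rewrite thick_mapE !ffunE thick_mapE; case: eqP. Qed.

(** A change of basis in the small spaces induces one in each of their copies, and
    it commutes with every factor of the block. *)
Lemma similar3_block R S : similar3 R S ->
  similar3 (block R) (block S :> 'End((thick W * thick W * thick W)%type)).
Proof.
case=> P1 [P2 [P3 [k1 k2 k3 RS]]].
exists (thick_map P1), (thick_map P2), (thick_map P3).
split; try exact: lker_thick_map.
move=> v; rewrite !block_alongE.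
elim: cube v => [|x s IHs] v //=; rewrite -IHs; congr foldl.
rewrite /place_fun /= !thick_mapE.
set w := (v.1.1 (line1 x), _, _).
have := RS w; rewrite /change_basis /= => ->.
by rewrite !set_copy_thick_map.
Qed.

End Thick.

Lemma lker0_scale (W1 W2 : vectType F) (g : 'Hom(W1, W2)) (h : W2 -> W1) c :
  c != 0 -> (forall x, h (g x) = c *: x) -> lker g == 0%VS.
Proof.
move=> c0 hg; apply/lker0P => x y gxy.
by apply: (scalerI c0); rewrite -!hg gxy.
Qed.

(** The scalars met in the change of basis below, for [x], [y], [z] the squares of
    the off-diagonal entries. *)
Fact basis_scalar (x y z c : F) : c = x * y * z -> c != 0 ->
  y^-1 / (x * x) = z / c / x /\ y^-1 / (x * x) * c = z / x.
Proof.
move=> cE c0.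
have z0 : z != 0 by move: c0; rewrite cE mulf_eq0 negb_or; case/andP.
have E : y^-1 / (x * x) = z / c / x.
  rewrite cE !invfM [z * _]mulrC mulfVK //.
  by rewrite [y^-1 * _]mulrA [x^-1 * y^-1]mulrC.
by split=> //; rewrite E mulrAC mulfVK.
Qed.

(** The inductive step. The first thick space keeps its basis, and the bases of
    the two others are transported from it by [comp12 / a12^2] and
    [comp13 / a13^2]; then [t'] is forced. *)
Lemma block_similar3_twisted_brick (V : vectType F) (A : 'M[F]_3) (t : 'End(V)) :
  involutive t -> A 0 1 * A 0 2 * A 1 2 != 0 ->
  exists t' : 'End(thick V),
    [/\ involutive t', \dim (limg (t' - \1)%VF) = \dim {:V}
      & similar3 (block (twisted_brick A t))
                 (twisted_brick (entrywise_pow A 2) t')].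
Proof.
move=> tK; set c := A 0 1 * _ * _ => c0.
have [a12 a13 a23] : [/\ A 0 1 != 0, A 0 2 != 0 & A 1 2 != 0].
  by move: c0; rewrite !mulf_eq0 !negb_or => /andP[/andP[-> ->] ->].
have c20 : c ^+ 2 != 0 by rewrite expf_neq0.
have cE : A 0 1 ^+ 2 * A 0 2 ^+ 2 * A 1 2 ^+ 2 = c ^+ 2 by rewrite -!exprMn.
pose N : 'End(thick V) := ((c ^+ 2)^-1 *: (defect_vec A t \o defect_form A t))%VF.
have NE x : N x = (c ^+ 2)^-1 *: defect_vec A t (defect_form A t x).
  by rewrite scale_lfunE comp_lfunE.
have tE x : (\1 + N)%VF x = x + N x by rewrite add_lfunE id_lfunE.
exists (\1 + N)%VF; split.
- move=> x; rewrite !tE [N (x + _)]linearD /= addrACA addrA.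
  have -> : N (N x) = 0 by rewrite !NE !linearZ /= (defect_form_vec A tK) !linear0.
  rewrite addr0 -addrA.
  have -> : N x + N x = 0 by rewrite -mulr2n -scaler_nat pcharf0 // scale0r.
  by rewrite addr0.
- rewrite [(\1 + N)%VF]addrC addrK.
  have form_onto : limg (defect_form A t) = fullv.
    apply/eqP; rewrite eqEsubv subvf; apply/subvP => w _.
    apply/memv_imgP; exists (quad (0, 0, 0, (A 0 1 * A 0 2)^-1 *: w)).
      exact: memvf.
    rewrite defect_form_quad ?(linear0, scaler0, add0r) scalerA.
    by rewrite mulfV ?scale1r ?mulf_neq0.
  have vec_inj : lker (defect_vec A t) == 0%VS.
    apply: (@lker0_scale _ _ _ (fun x : thick V => x (false, false))
              (A 0 1 * A 0 2)).
      by rewrite mulf_neq0.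
    by move=> w; rewrite defect_vecE ffunE.
  have -> : limg N = limg (defect_vec A t \o defect_form A t).
    apply/eqP; rewrite eqEsubv.
    apply/andP; split; apply/subvP=> y /memv_imgP[x _ ->].
      by rewrite /N scale_lfunE memvZ ?memv_img ?memvf.
    have -> : (defect_vec A t \o defect_form A t)%VF x = N (c ^+ 2 *: x).
      by rewrite /N scale_lfunE linearZ scalerA mulVf ?scale1r ?expf_neq0.
    by rewrite memv_img ?memvf.
  by rewrite limg_comp form_onto limg_dim_eq // (eqP vec_inj) capv0.
(* These choices make the components from space 1 equal to [a12^2], [a13^2]. *)
exists \1%VF, ((A 0 1 ^+ 2)^-1 *: comp12 A t)%VF,
  ((A 0 2 ^+ 2)^-1 *: comp13 A t)%VF.
have lkerZ k (g : 'End(thick V)) : k != 0 -> lker g == 0%VS ->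
    lker (k *: g)%VF == 0%VS.
  move=> k0 kg; apply/lker0P => x y; rewrite !scale_lfunE.
  by move/(scalerI k0)/(lker0P kg).
split.
- by apply/lker0P => x y; rewrite !id_lfunE.
- apply: lkerZ; first by rewrite invr_neq0 // expf_neq0.
  apply: (@lker0_scale _ _ _ (comp21 A t) (A 0 1 ^+ 2 * A 0 1 ^+ 2)).
    by rewrite mulf_neq0 ?expf_neq0.
  by move=> x; rewrite comp21_comp12 // scalerA.
- apply: lkerZ; first by rewrite invr_neq0 // expf_neq0.
  apply: (@lker0_scale _ _ _ (comp31 A t) (A 0 2 ^+ 2 * A 0 2 ^+ 2)).
    by rewrite mulf_neq0 ?expf_neq0.
  by move=> x; rewrite comp31_comp13 // scalerA.
case=> [[x y] z].
rewrite block_twisted_brickE // twisted_brickE /change_basis /twisted_brick_fun /=.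
rewrite !mxE !id_lfunE !scale_lfunE !tE !NE.
have e21 : comp21 A t ((A 0 1 ^+ 2)^-1 *: comp12 A t y) = A 0 1 ^+ 2 *: y.
  by rewrite linearZ /= comp21_comp12 // scalerK ?expf_neq0.
have e31 : comp31 A t ((A 0 2 ^+ 2)^-1 *: comp13 A t z) = A 0 2 ^+ 2 *: z.
  by rewrite linearZ /= comp31_comp13 // scalerK ?expf_neq0.
have e32 : comp32 A t (comp13 A t z) = (A 0 1 ^+ 2 * A 0 1 ^+ 2)^-1 *:
    (c ^+ 2 *: comp12 A t z + comp12 A t (defect_vec A t (defect_form A t z))).
  by rewrite -comp32_comp13 // [_ *: (_ *: _)]scalerA scalerK // !mulf_neq0.
have e23 : comp23 A t (comp12 A t y) = (A 0 2 ^+ 2 * A 0 2 ^+ 2)^-1 *: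
    (c ^+ 2 *: comp13 A t y + comp13 A t (defect_vec A t (defect_form A t y))).
  by rewrite -comp23_comp12 // [_ *: (_ *: _)]scalerA scalerK // !mulf_neq0.
have [k2 k2c] := basis_scalar (x := A 0 1 ^+ 2) (y := A 0 2 ^+ 2) (z := A 1 2 ^+ 2)
  (esym cE) c20.
have [k3 k3c] := basis_scalar (x := A 0 2 ^+ 2) (y := A 0 1 ^+ 2) (z := A 1 2 ^+ 2)
  (esym (etrans (congr1 ( *%R^~ _) (mulrC _ _)) cE)) c20.
congr (_, _, _).
- by rewrite e21 e31.
- rewrite !linearD /= !linearZ /= e32 !scalerDr !scalerA k2c k2 mulfV ?expf_neq0 //.
  by rewrite scale1r [A 1 1 ^+ 2 / _]mulrC.
- rewrite !linearD /= !linearZ /= e23 !scalerDr !scalerA k3c k3 mulfV ?expf_neq0 //.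
  by rewrite scale1r [A 2 2 ^+ 2 / _]mulrC.
Qed.

(** The rank statement fails at [n = 0], where [t = 1]; from the first step on it is
    the dimension of the space of the previous step. *)
Lemma iter_block_similar3 (A : 'M[F]_3) n : A^T = A ->
  A 0 1 * A 0 2 * A 1 2 != 0 ->
  exists t : 'End(iter_space F n),
    [/\ involutive t, (0 < n)%N -> \dim (limg (t - \1)%VF) = (4 ^ n.-1)%N
      & similar3 (iter_block A n) (twisted_brick (entrywise_pow A (2 ^ n)) t)].
Proof.
move=> A_sym A_off; have sym i j : A i j = A j i by rewrite -[in LHS]A_sym mxE.
elim: n => [|n [t [tK _ simt]]].
  exists \1%VF; split=> //; first by move=> x; rewrite !id_lfunE.
  exists \1%VF, \1%VF, \1%VF.
  have k1 : lker (\1%VF : 'End(iter_space F 0)) == 0%VS.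
    by apply/lker0P => x y; rewrite !id_lfunE.
  split=> // -[[x y] z]; rewrite /change_basis !id_lfunE /=.
  rewrite matrix_brickE twisted_brickE /matrix_brick_fun /twisted_brick_fun /=.
  rewrite !id_lfunE !mxE !expr1 (sym 1 0) (sym 2 0) (sym 2 1).
  by congr (_, _, _); rewrite !(mulrC _ (A _ _)).
have [|t' [tK' dimt' simt']] :=
    @block_similar3_twisted_brick _ (entrywise_pow A (2 ^ n)) t tK.
  by rewrite !mxE -!exprMn expf_neq0.
exists t'; split=> // [_|]; first by rewrite dimt' dim_iter_space.
have -> : entrywise_pow A (2 ^ n.+1) = entrywise_pow (entrywise_pow A (2 ^ n)) 2.
  by apply/matrixP=> i j; rewrite !mxE -exprM expnSr.
exact: similar3_trans (similar3_block simt) simt'.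
Qed.

End Char2.

(** * Jordan decomposition *)

(** An operator of square zero and rank [m] has [m] Jordan blocks of size 2. The
    [c i] form a basis of a complement of the kernel, the [N (c i)] then form a
    basis of the image, and the [d j] complete it to a basis of the kernel. *)
Lemma square_zero_basis (F : fieldType) (W : vectType F) (N : 'End(W)) m k :
  (forall x, N (N x) = 0) -> \dim (limg N) = m -> \dim {:W} = (k + m + m)%N ->
  exists (c : 'I_m -> W) (d : 'I_k -> W),
  (forall j, N (d j) = 0) /\
  ((\sum_j <[d j]> + \sum_i <<[:: c i; N (c i)]>>)%VS = fullv).
Proof.
move=> N0 dimN dimW.
pose K := lker N; pose C := (K^C)%VS; pose D := (K :\: limg N)%VS.
have IK : (limg N <= K)%VS.
  by apply/subvP => x /memv_imgP[y _ ->]; rewrite memv_ker N0.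
have KC : (K + C = fullv)%VS by exact: addv_complf.
have sizeC : size (vbasis C) = m.
  by rewrite size_tuple dimv_compl -(limg_ker_dim N fullv) capfv addKn dimN.
have dimK : \dim K = (k + m)%N.
  by apply/eqP; rewrite -(eqn_add2r m) -dimW -(limg_ker_dim N fullv) capfv dimN.
have DK : (D + limg N = K)%VS.
  by rewrite -[RHS](addv_diff_cap K (limg N)) (capv_idPr IK).
have sizeD : size (vbasis D) = k.
  apply/eqP; rewrite size_tuple -(eqn_add2r m) -dimK -(dimv_cap_compl K (limg N)).
  by rewrite (capv_idPr IK) dimN addnC.
exists (fun i => (vbasis C)`_i), (fun j => (vbasis D)`_j); split=> [j|].
  apply/eqP; rewrite -memv_ker; apply: (subvP (diffvSl K (limg N))).
  by apply: vbasis_mem; rewrite mem_nth // sizeD.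
apply/eqP; rewrite eqEsubv subvf /=.
set S := (_ + _)%VS.
have CS : (C <= S)%VS.
  rewrite -(span_basis (vbasisP C)); apply/span_subvP => x /(nthP 0)[i].
  rewrite sizeC => im <-; apply: (subvP (addvSr _ _)).
  apply: (subvP (sumv_sup (Ordinal im) _ (subvv _))) => //.
  by apply: memv_span; rewrite mem_head.
have IS : (limg N <= S)%VS.
  have -> : limg N = (N @: C)%VS.
    by rewrite -KC limgD -/K (eqP (_ : (N @: K == 0)%VS)) ?add0v // -lkerE.
  rewrite -(span_basis (vbasisP C)) limg_span; apply/span_subvP => x.
  case/mapP => y /(nthP 0)[i]; rewrite sizeC => im <- ->.
  apply: (subvP (addvSr _ _)).
  apply: (subvP (sumv_sup (Ordinal im) _ (subvv _))) => //.
  by apply: memv_span; rewrite !inE eqxx orbT.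
have DS : (D <= S)%VS.
  rewrite -(span_basis (vbasisP D)); apply/span_subvP => x /(nthP 0)[j].
  rewrite sizeD => jk <-; apply: (subvP (addvSl _ _)).
  by apply: (subvP (sumv_sup (Ordinal jk) _ (subvv _))) => //; exact: memv_line.
by rewrite -KC -DK !subv_add DS IS CS.
Qed.

Section Spanning.
Variables (F : fieldType) (W : vectType F) (K : finType) (X : K -> seq W).

(** Spanning families with as many vectors in total as the dimension leave no room
    for a linear relation, neither inside a family nor between families. *)
Lemma direct_decomp_span : (\sum_k <<X k>>)%VS = fullv ->
  (\sum_k size (X k))%N = \dim {:W} ->
  direct_decomp (fun k => <<X k>>%VS) /\ forall k, basis_of <<X k>> (X k).
Proof.
move=> spanX sizeX.
have le_size k : (\dim <<X k>> <= size (X k) ?= iff free (X k))%N.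
  by split; [exact: dim_span | rewrite /free].
have le_sum := leqif_sum (P := predT) (fun k _ => le_size k).
have eq_sum : (\sum_k \dim <<X k>> = \dim {:W})%N.
  by apply/eqP; rewrite eqn_leq -{1}sizeX le_sum -spanX dimv_leq_sum.
split; first by split; rewrite // directvE /= spanX eq_sum.
move=> k; rewrite /basis_of eqxx /=.
have /forallP/(_ k)/implyP/(_ isT) // : [forall (k | true), free (X k)].
by rewrite -le_sum.2 eq_sum sizeX.
Qed.

End Spanning.

(** * Splitting a twisted brick *)

Section Summands.
Variables (F : fieldType).

Definition comb (W : vectType F) d (X : d.-tuple W) (c : 'rV[F]_d) : W :=
  \sum_i c 0 i *: tnth X i.

Fact comb_is_linear (W : vectType F) d (X : d.-tuple W) : linear (comb X).
Proof.
move=> k c1 c2; rewrite /comb scaler_sumr -big_split; apply: eq_bigr => i _.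
by rewrite !mxE scalerDl scalerA.
Qed.

HB.instance Definition _ (W : vectType F) d (X : d.-tuple W) :=
  GRing.isLinear.Build F _ _ _ (comb X) (comb_is_linear X).

Lemma comb_map (W : vectType F) d (P : 'End(W)) (X : d.-tuple W) c :
  comb (map_tuple P X) c = P (comb X c).
Proof.
by rewrite linear_sum; apply: eq_bigr => i _; rewrite tnth_map linearZ.
Qed.

Lemma comb_scalar (W : vectType F) d (X : d.-tuple W) c a :
  comb X (c *m a%:M) = a *: comb X c.
Proof. by rewrite mul_mx_scalar linearZ. Qed.

Lemma mem_comb (W : vectType F) d (U : {vspace W}) (X : d.-tuple W) x :
  basis_of U X -> x \in U <-> exists c, x = comb X c.
Proof.
move=> bX; split=> [xU|[c ->]].
  exists (\row_i coord X i x); rewrite {1}(coord_basis bX xU).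
  by apply: eq_bigr => i _; rewrite mxE (tnth_nth 0).
by rewrite memv_suml // => i _; rewrite memvZ // (basis_mem bX) // mem_tnth.
Qed.

Lemma preserves3_acts_as (W1 W2 W3 : vectType F)
    (R : 'End((W1 * W2 * W3)%type)) U1 U2 U3 b :
  acts_as R U1 U2 U3 b -> preserves3 R U1 U2 U3.
Proof.
case=> e1 [e2 [e3 [b1 b2 b3 actR]]] [[v1 v2] v3] /= [].
move=> /(mem_comb _ b1)[c1 ->] /(mem_comb _ b2)[c2 ->] /(mem_comb _ b3)[c3 ->].
have -> : (comb e1 c1, comb e2 c2, comb e3 c3) =
    vec3 e1 e2 e3 (row_mx (row_mx c1 c2) c3).
  by rewrite /vec3 !(row_mxKl, row_mxKr).
rewrite actR; split; [apply/(mem_comb _ b1) | apply/(mem_comb _ b2)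
  | apply/(mem_comb _ b3)]; by eexists.
Qed.

(** The common shape of the two bricks: [double_brick M] is the case [T = Tmx] by
    definition, and [simple_brick M] the case [d = 1], [T = 1]. *)
Definition block_brick d (M : 'M[F]_3) (T : 'M[F]_d) : mxbrick F :=
  @MxBrick F d d d
    (block_mx
       (block_mx (M 0 0)%:M (M 0 1)%:M
                 (M 0 1)%:M (M 1 1)%:M)
       (col_mx (M 0 2)%:M (M 1 2 *: T))
       (row_mx (M 0 2)%:M (M 1 2 *: T))
       (M 2 2)%:M).

Lemma simple_brickE (M : 'M[F]_3) : M^T = M ->
  simple_brick M = block_brick M (1%:M : 'M_1).
Proof.
move=> M_sym; have sym i j : M i j = M j i by rewrite -[in LHS]M_sym mxE.
congr MxBrick; apply/matrixP => i j.
have [i0 ->|i1 ->] := split_ordP i; have [j0 ->|j1 ->] := split_ordP j;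
  rewrite ?(block_mxEul, block_mxEur, block_mxEdl, block_mxEdr);
  try (have [{}i0 ->|i1 ->] := split_ordP i0);
  try (have [{}j0 ->|j1 ->] := split_ordP j0);
  rewrite ?(block_mxEul, block_mxEur, block_mxEdl, block_mxEdr);
  rewrite ?(col_mxEu, col_mxEd, row_mxEl, row_mxEr) !mxE !ord1 ?mulr1n ?mulr1.
all: by [congr (M _ _); apply/val_inj | rewrite sym; congr (M _ _); apply/val_inj].
Qed.

(** A family [X] spanning a [t]-stable subspace, on which [t] has the matrix [T],
    cuts the brick with the twist [T] out of a twisted brick. *)
Lemma acts_as_block_brick (W : vectType F) (R : 'End((W * W * W)%type))
    (M : 'M[F]_3) (t P1 P2 P3 : 'End(W)) U1 U2 U3 d (X : d.-tuple W) T :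
  (forall v, R (change_basis P1 P2 P3 v) =
             change_basis P1 P2 P3 (twisted_brick M t v)) ->
  (forall c, t (comb X c) = comb X (c *m T)) ->
  basis_of U1 (map P1 X) -> basis_of U2 (map P2 X) -> basis_of U3 (map P3 X) ->
  acts_as R U1 U2 U3 (block_brick M T).
Proof.
move=> simR tX b1 b2 b3.
exists (map_tuple P1 X), (map_tuple P2 X), (map_tuple P3 X); split=> // c.
have vecE (e : 'rV_(d + d + d)) :
    vec3 (map_tuple P1 X) (map_tuple P2 X) (map_tuple P3 X) e =
    change_basis P1 P2 P3 (comb X (lsubmx (lsubmx e)),
      comb X (rsubmx (lsubmx e)), comb X (rsubmx e)).
  by rewrite /change_basis -!comb_map.
rewrite !vecE simR; congr change_basis.
rewrite twisted_brickE // /twisted_brick_fun /=.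
rewrite -(hsubmxK c) -(hsubmxK (lsubmx c)).
rewrite mul_row_block mul_row_block mul_mx_row mul_row_col add_row_mx.
rewrite !(row_mxKl, row_mxKr) !linearD /= !comb_scalar -!scalemxAr !linearZ /=.
by rewrite !tX.
Qed.

End Summands.

Fact pow4_pred n : (4 ^ n.-1 = 2 ^ (2 * n - 2))%N.
Proof. by rewrite (_ : 2 * n - 2 = 2 * n.-1)%N ?(expnM 2 2) // -subn1 mulnBr. Qed.

Fact pow4_split n : (0 < n)%N ->
  (4 ^ n = 2 ^ (2 * n - 1) + 2 ^ (2 * n - 2) + 2 ^ (2 * n - 2))%N.
Proof.
case: n => // n _; rewrite -[4%N]/(2 ^ 2)%N -expnM mulnS addKn addSn subn1 /=.
by rewrite -addnA addnn -mul2n -expnS addnn -mul2n -expnS.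
Qed.

Theorem corollary17 (F : finFieldType) (char2 : 2%N \in [pchar F])
    (A : 'M[F]_3) (A_sym : A^T = A) (A_off : A 0 1 * A 0 2 * A 1 2 != 0)
    (n : nat) (n_ge1 : (1 <= n)%N) :
  is_direct_sum (iter_block A n)
    (fun k : 'I_(2 ^ (2 * n - 1)) + 'I_(2 ^ (2 * n - 2)) =>
       match k with
       | inl _ => simple_brick (entrywise_pow A (2 ^ n))
       | inr _ => double_brick (entrywise_pow A (2 ^ n))
       end).
Proof.
have [t [tK dimN [P1 [P2 [P3 [k1 k2 k3 simR]]]]]] :=
  iter_block_similar3 char2 n A_sym A_off.
pose N := (t - \1)%VF.
have tE x : t x = x + N x by rewrite add_lfunE opp_lfunE id_lfunE addrC subrK.
have dbl (x : iter_space F n) : x + x = 0.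
  by rewrite -mulr2n -scaler_nat (pcharf0 char2) scale0r.
have N0 x : N (N x) = 0.
  have NE y : N y = t y + y.
    by apply/eqP; rewrite tE addrAC dbl add0r.
  by rewrite !NE linearD /= tK [x + _]addrC dbl.
have [||c [d [Nd full]]] := @square_zero_basis _ _ N
    (2 ^ (2 * n - 2))%N (2 ^ (2 * n - 1))%N N0.
- by rewrite dimN // pow4_pred.
- by rewrite dim_iter_space pow4_split.
(* One Jordan block of [N] for each summand. *)
pose X k := match k with inl j => [:: d j] | inr i => [:: c i; N (c i)] end.
have fullX : (\sum_k <<X k>>)%VS = fullv.
  rewrite -full big_sumType /=; congr (_ + _)%VS.
  by apply: eq_bigr => j _; rewrite span_seq1.
have sizeX : (\sum_k size (X k))%N = \dim {: iter_space F n}.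
  rewrite big_sumType /= !sum_nat_const !card_ord dim_iter_space pow4_split //.
  by rewrite muln1 muln2 -addnn addnA.
have decomp (P : 'End(iter_space F n)) : lker P == 0%VS ->
    direct_decomp (fun k => <<map P (X k)>>%VS) /\
    forall k, basis_of <<map P (X k)>> (map P (X k)).
  move=> kP; apply: direct_decomp_span.
    under eq_bigr => k _ do rewrite -limg_span.
    by rewrite -limg_sum fullX lker0_limgf.
  by rewrite -sizeX; apply: eq_bigr => k _; rewrite size_map.
have [dir1 b1] := decomp _ k1.
have [dir2 b2] := decomp _ k2.
have [dir3 b3] := decomp _ k3.
exists (fun k => <<map P1 (X k)>>%VS), (fun k => <<map P2 (X k)>>%VS),
  (fun k => <<map P3 (X k)>>%VS).
split=> // k.
suff act : acts_as (iter_block A n)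
    <<map P1 (X k)>> <<map P2 (X k)>> <<map P3 (X k)>>
    match k with
    | inl _ => simple_brick (entrywise_pow A (2 ^ n))
    | inr _ => double_brick (entrywise_pow A (2 ^ n))
    end by split=> //; apply: preserves3_acts_as act.
have := And3 (b1 k) (b2 k) (b3 k); case: k => [j|i] [b1k b2k b3k].
  rewrite simple_brickE; last first.
    by apply/matrixP => i1 i2; rewrite !mxE -[in LHS]A_sym mxE.
  apply: (acts_as_block_brick (X := [tuple d j]) simR) => // e.
  by rewrite mulmx1 /comb big_ord1 linearZ /= tE (tnth_nth 0) /= Nd addr0.
apply: (acts_as_block_brick (X := [tuple c i; N (c i)]) simR) => // e.
rewrite /comb !big_ord_recl !big_ord0 !(tnth_nth 0) /= !addr0.
rewrite linearD !linearZ /= !tE N0 addr0.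
rewrite !mxE !big_ord_recl !big_ord0 !mxE /= !mulr1 mulr0 !addr0.
by rewrite scalerDr scalerDl addrA.
Qed.
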